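(* Let $\varphi,u_1,u_2:\mathbb R_+^2\to\mathbb R_+$ each satisfy properties (I)–(IV) listed in the context, and let $\mathbf R^0=(\mathbf r_0^0,\mathbf r_1^0,\mathbf r_2^0)$ be an interior initial market state. Write $p_0^0=p(\varphi,\mathbf r_0^0)$ and $p_i^0=p(u_i,\mathbf r_i^0)$ for $i=1,2$. Let $T_i(\mathbf R)$ denote the state obtained from an interior state $\mathbf R$ after agent $i$ makes her unique utility-maximizing trade; put $\mathbf R^{i}=T_i(\mathbf R^0)=(\mathbf r_0^i,\mathbf r_1^i,\mathbf r_2^i)$ and $q_i:=p(\varphi,\mathbf r_0^i)$ for $i=1,2$, and put $\mathbf R^{12}=T_2(T_1(\mathbf R^0))$, $\mathbf R^{21}=T_1(T_2(\mathbf R^0))$, with agent $j$'s holdings in these states denoted $\mathbf r_j^{12}$ and $\mathbf r_j^{21}$. (i) Suppose that $(p_0^0-p_1^0)(p_0^0-p_2^0)>0$ and in addition that $$(p_0^0-p_1^0)(q_2-p_1^0)>0\quad\text{and}\quad(p_0^0-p_2^0)(q_1-p_2^0)>0.$$ Then $$u_1(\mathbf r_1^{12})>u_1(\mathbf r_1^{21}),\qquad u_2(\mathbf r_2^{21})>u_2(\mathbf r_2^{12}).$$ (ii) Suppose that $(p_0^0-p_1^0)(p_0^0-p_2^0)<0$. Then $$u_1(\mathbf r_1^{12})<u_1(\mathbf r_1^{21}),\qquad u_2(\mathbf r_2^{21})<u_2(\mathbf r_2^{12}).$$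
   Context: Notation: $\mathbb R_+=[0,\infty)$, $\mathbb R_{++}=(0,\infty)$. For a function $u$ that is differentiable with nonzero partial derivatives at $\mathbf r=(x,y)$, put $p(u,\mathbf r)=p(u,x,y):=\partial_xu(x,y)/\partial_yu(x,y)$. Properties of a function $u:\mathbb R_+^2\to\mathbb R_+$: (I) $u$ is continuous, $u(x,0)=u(0,y)=0$ for all $x,y\in\mathbb R_+$, and $u$ is strictly increasing (in each coordinate) on $\mathbb R_{++}^2$. (II) $\lim_{x'\to\infty}u(x',y)=\infty$ and $\lim_{y'\to\infty}u(x,y')=\infty$ for every $x,y>0$. (III) $u$ is continuously differentiable and strictly concave on $\mathbb R_{++}^2$. (IV) For any $x_1,x_2,y_1,y_2\in\mathbb R_{++}$ with $x_1\le x_2$ and $y_1\ge y_2$, at least one inequality strict, $p(u,x_1,y_1)>p(u,x_2,y_2)$ whenever the prices are defined. Market: there is one constant-function market maker (CFMM) with trading function $\varphi$ and two agents with utilities $u_1,u_2$. A market state is $\mathbf R=(\mathbf r_0,\mathbf r_1,\mathbf r_2)\in(\mathbb R_+^2)^3$ ($\mathbf r_0$ = CFMM inventory, $\mathbf r_i$ = holding of agent $i$); it is interior if it lies in $(\mathbb R_{++}^2)^3$. A trade $\mathbf h\in\mathbb R^2$ is valid for $\mathbf R$ and agent $i\in\{1,2\}$ if $\mathbf r_0+\mathbf h\in\mathbb R_+^2$, $\varphi(\mathbf r_0+\mathbf h)=\varphi(\mathbf r_0)$ and $\mathbf r_i-\mathbf h\in\mathbb R_+^2$; executing it replaces $\mathbf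 r_0$ by $\mathbf r_0+\mathbf h$, $\mathbf r_i$ by $\mathbf r_i-\mathbf h$, and leaves the other holding unchanged. The utility-maximizing trade of agent $i$ at an interior state is the (unique, under (I)–(IV)) valid trade $\mathbf h$ maximizing $u_i(\mathbf r_i-\mathbf h)$; the resulting state is again interior. *)

(* Defs.v *)
From HB Require Import structures.
From mathcomp Require Export all_boot all_order all_algebra.
From mathcomp Require Export all_classical all_reals all_analysis.
Export Order.TTheory GRing.Theory Num.Theory numFieldNormedType.Exports.

Set Implicit Arguments.
Unset Strict Implicit.
Unset Printing Implicit Defensive.

Local Open Scope classical_set_scope.
Local Open Scope ring_scope.

Definition quadrant (R : realType) : set (R * R) :=
  [set r | 0 <= r.1 /\ 0 <= r.2].

Definition open_quadrant (R : realType) : set (R * R) :=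
  [set r | 0 < r.1 /\ 0 < r.2].

Arguments quadrant {R}.
Arguments open_quadrant {R}.

(* A function u : R_+^2 -> R_+ is represented by a total u : R * R -> R, whose
   values outside [quadrant] are irrelevant: prices and derivatives are only
   considered at points of [open_quadrant]. *)

Definition partial_x (R : realType) (u : R * R -> R) (r : R * R) : R :=
  'D_(1, 0) u r.

Definition partial_y (R : realType) (u : R * R -> R) (r : R * R) : R :=
  'D_(0, 1) u r.

Definition price_defined (R : realType) (u : R * R -> R) (r : R * R) : Prop :=
  [/\ differentiable u r, partial_x u r != 0 & partial_y u r != 0].

Definition price (R : realType) (u : R * R -> R) (r : R * R) : R :=
  partial_x u r / partial_y u r.

Definition nonneg_valued (R : realType) (u : R * R -> R) : Prop :=
  forall r, quadrant r -> 0 <= u r.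

(* Continuity is that of the restriction to R_+^2 (subspace topology); u is not
   assumed to be continuous across the axes. *)
Definition continuous_increasing (R : realType) (u : R * R -> R) : Prop :=
  [/\ {within quadrant, continuous u},
      forall x : R, 0 <= x -> u (x, 0) = 0,
      forall y : R, 0 <= y -> u (0, y) = 0,
      forall x x' y : R, 0 < x -> x < x' -> 0 < y -> u (x, y) < u (x', y) &
      forall x y y' : R, 0 < x -> 0 < y -> y < y' -> u (x, y) < u (x, y')].

Definition unbounded_growth (R : realType) (u : R * R -> R) : Prop :=
  (forall y : R, 0 < y -> u (x', y) @[x' --> +oo] --> +oo) /\
  (forall x : R, 0 < x -> u (x, y') @[y' --> +oo] --> +oo).

(* Continuity of the differential on a two-dimensional domain amounts to
   continuity of the two partial derivatives. *)
Definition continuously_differentiable (R : realType) (u : R * R -> R) : Prop :=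
  forall r, open_quadrant r ->
    [/\ differentiable u r,
        {for r, continuous (partial_x u)} &
        {for r, continuous (partial_y u)}].

Definition strictly_concave (R : realType) (u : R * R -> R) : Prop :=
  forall (a b : R * R) (t : R), open_quadrant a -> open_quadrant b -> a != b ->
    0 < t -> t < 1 ->
    t * u a + (1 - t) * u b < u (t *: a + (1 - t) *: b).

Definition decreasing_price (R : realType) (u : R * R -> R) : Prop :=
  forall x1 x2 y1 y2 : R, 0 < x1 -> 0 < x2 -> 0 < y1 -> 0 < y2 ->
    x1 <= x2 -> y2 <= y1 -> (x1 < x2 \/ y2 < y1) ->
    price_defined u (x1, y1) -> price_defined u (x2, y2) ->
    price u (x2, y2) < price u (x1, y1).

Definition regular_function (R : realType) (u : R * R -> R) : Prop :=
  nonneg_valued u /\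
  [/\ continuous_increasing u,
      unbounded_growth u,
      continuously_differentiable u /\ strictly_concave u &
      decreasing_price u].

Inductive agent := agent1 | agent2.

Record market_state (R : realType) := MarketState {
  cfmm : R * R;
  holding1 : R * R;
  holding2 : R * R
}.

Definition holding (R : realType) (S : market_state R) (i : agent) : R * R :=
  match i with agent1 => holding1 S | agent2 => holding2 S end.

Definition interior_state (R : realType) (S : market_state R) : Prop :=
  [/\ open_quadrant (cfmm S), open_quadrant (holding1 S) &
      open_quadrant (holding2 S)].

Definition valid_trade (R : realType) (phi : R * R -> R) (S : market_state R)
    (i : agent) (h : R * R) : Prop :=
  [/\ quadrant (cfmm S + h), phi (cfmm S + h) = phi (cfmm S) &
      quadrant (holding S i - h)].

Definition execute (R : realType) (S : market_state R) (i : agent)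
    (h : R * R) : market_state R :=
  match i with
  | agent1 => MarketState (cfmm S + h) (holding1 S - h) (holding2 S)
  | agent2 => MarketState (cfmm S + h) (holding1 S) (holding2 S - h)
  end.

Definition utility_maximizing (R : realType) (phi u : R * R -> R)
    (S : market_state R) (i : agent) (h : R * R) : Prop :=
  valid_trade phi S i h /\
  forall h', valid_trade phi S i h' -> u (holding S i - h') <= u (holding S i - h).

(* The maximizer is picked by choice, with the null trade as the default value
   if there is none; at interior states there is exactly one when phi and u
   satisfy [regular_function], so neither the choice nor the default matters. *)
Definition best_trade (R : realType) (phi u : R * R -> R)
    (S : market_state R) (i : agent) : R * R :=
  xget 0 [set h | utility_maximizing phi u S i h].

Definition after_best_trade (R : realType) (phi u : R * R -> R) (i : agent)
    (S : market_state R) : market_state R :=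
  execute S i (best_trade phi u S i).

(* Main.v *)
Require Import Defs.
From mathcomp Require Import ring lra.

Set Implicit Arguments.
Unset Strict Implicit.
Unset Printing Implicit Defensive.

Local Open Scope classical_set_scope.
Local Open Scope ring_scope.

(* At a best trade an agent moves the CFMM in the direction in which the gap
   between the CFMM price and her own price points. Whatever the CFMM inventory,
   it lies on one fixed level curve of [phi], which is strictly convex. So if
   another agent moves the CFMM from [A] to [B] along this curve and the best
   trade then takes it from [B] further in the same direction to [C], the same
   net trade executed at [A] leads to [A + C - B], strictly above the curve: the
   agent would have got the same goods more cheaply, i.e. she prefers to trade
   at [A]. Both parts apply this with a suitable choice of which of the two
   inventories, before or after the other agent's trade, plays the role of [A].
*)

(** * Existence of best trades *)

Definition nonneg_part (R : realType) (r : R * R) : R * R :=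
  (Num.max r.1 0, Num.max r.2 0).

Lemma quadrant_nonneg_part (R : realType) (r : R * R) :
  quadrant (nonneg_part r).
Proof. by rewrite /quadrant /nonneg_part /= !le_max !lexx !orbT. Qed.

Lemma nonneg_part_id (R : realType) (r : R * R) :
  quadrant r -> nonneg_part r = r.
Proof. by case: r => x y [/= x0 y0]; rewrite /nonneg_part /= !max_l. Qed.

(** [nonneg_part] retracts the plane onto the closed quadrant. Precomposing with it turns a function
    continuous only on the quadrant into one continuous everywhere, with the same values on the
    quadrant. *)
Lemma continuous_nonneg_part (R : realType) (u : R * R -> R) :
  {within quadrant, continuous u} -> continuous (u \o @nonneg_part R).
Proof.
move=> /subspace_continuousP cu r.
have /cu {}cu := quadrant_nonneg_part r.
move=> A /cu rA.
have c1 : Num.max s.1 0 @[s --> r] --> Num.max r.1 0.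
  have := @continuous_max R _ (fst : R * R -> R^o) (cst 0) r.
  by apply; [exact: cvg_fst | exact: cvg_cst].
have c2 : Num.max s.2 0 @[s --> r] --> Num.max r.2 0.
  have := @continuous_max R _ (snd : R * R -> R^o) (cst 0) r.
  by apply; [exact: cvg_snd | exact: cvg_cst].
have cpr : nonneg_part s @[s --> r] --> nonneg_part r by exact: cvg_pair c1 c2.
have /= := cpr _ rA; rewrite /nbhs /=.
by apply: filterS => s; apply; exact: quadrant_nonneg_part.
Qed.

Lemma open_quadrantW (R : realType) (r : R * R) : open_quadrant r -> quadrant r.
Proof. by move=> [/ltW ? /ltW ?]. Qed.

(** The valid trades form a nonempty compact set, on which the agent's utility is continuous. *)
Lemma exists_utility_maximizing (R : realType) (phi u : R * R -> R)
    (S : market_state R) (i : agent) :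
  {within quadrant, continuous phi} -> {within quadrant, continuous u} ->
  quadrant (cfmm S) -> quadrant (holding S i) ->
  exists h, utility_maximizing phi u S i h.
Proof.
move=> /continuous_nonneg_part cphi /continuous_nonneg_part cu q0 qi.
set r0 := cfmm S in q0 *; set ri := holding S i in qi *.
have cadd : continuous (fun h : R * R => r0 + h).
  by move=> h; apply: cvgD; [exact: cvg_cst | exact: cvg_id].
have csub : continuous (fun h : R * R => ri - h).
  by move=> h; apply: cvgB; [exact: cvg_cst | exact: cvg_id].
(* The lower bounds keep the CFMM inventory nonnegative, the upper bounds the agent's holding. *)
pose A : set (R * R) := (`[- r0.1, ri.1] `*` `[- r0.2, ri.2]) `&`
  ((fun h => phi (nonneg_part (r0 + h))) @^-1` [set phi r0]).
have AP h : A h <-> valid_trade phi S i h.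
  rewrite /A /valid_trade /quadrant -/r0 -/ri /= !in_itv /=.
  split.
    move=> [[/andP[? ?] /andP[? ?]] e].
    have q : quadrant (r0 + h) by split => /=; lra.
    by rewrite nonneg_part_id // in e; split=> //; split; lra.
  move=> [[? ?] e [? ?]]; rewrite nonneg_part_id ?e; last by split.
  by split=> //; split; apply/andP; split; lra.
have A0 : A !=set0.
  by exists 0; apply/AP; split; rewrite -/r0 -/ri ?addr0 ?subr0.
have cA : compact A.
  apply: (@subclosed_compact _ _ (`[- r0.1, ri.1] `*` `[- r0.2, ri.2])).
  - apply: closedI.
      apply: compact_closed; first exact: norm_hausdorff.
      by apply: compact_setX; exact: segment_compact.
    apply: (@preimage_closed _ _ ((phi \o @nonneg_part R) \o (fun h => r0 + h))).
      move=> h _; apply: (@continuous_comp _ _ _ (fun h => r0 + h)).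
        exact: cadd.
      exact: cphi.
    exact: closed_eq.
  - by apply: compact_setX; exact: segment_compact.
  - by move=> h [].
have cuA : continuous (fun h : R * R => u (nonneg_part (ri - h))).
  move=> h; refine (@continuous_comp _ _ _ (fun h : R * R => ri - h)
    (u \o @nonneg_part R) h (csub h) _).
  exact: cu.
have [h /[!inE] Ah hmax] := compact_EVT_max A0 cA (continuous_subspaceT cuA).
exists h; split; first exact/AP.
move=> h' vh'; have /AP/mem_set/hmax := vh'; move: vh'.
by have /AP [_ _ qh] := Ah; move=> [_ _ qh'] /=; rewrite !nonneg_part_id.
Qed.

Lemma best_tradeP (R : realType) (phi u : R * R -> R) (S : market_state R)
    (i : agent) :
  {within quadrant, continuous phi} -> {within quadrant, continuous u} ->
  quadrant (cfmm S) -> quadrant (holding S i) ->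
  utility_maximizing phi u S i (best_trade phi u S i).
Proof.
move=> cphi cu q0 qi.
have [h hP] := exists_utility_maximizing cphi cu q0 qi.
exact: (@xgetI _ 0 [set h | utility_maximizing phi u S i h] h hP).
Qed.

(** * Positivity and improvement of trades *)

(** Halving the first coordinate strictly lowers the value, which stays nonnegative. *)
Lemma pos_open_quadrant (R : realType) (u : R * R -> R) (r : R * R) :
  nonneg_valued u -> continuous_increasing u -> open_quadrant r -> 0 < u r.
Proof.
move=> u0 [_ _ _ ux _] [x0 y0]; case: r x0 y0 => x y /= x0 y0.
have x20 : 0 < x / 2 by lra.
have xx : x / 2 < x by lra.
by apply: le_lt_trans (ux _ _ _ x20 xx y0); apply: u0; split => /=; lra.
Qed.

Lemma open_quadrant_pos (R : realType) (u : R * R -> R) (r : R * R) :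
  continuous_increasing u -> quadrant r -> 0 < u r -> open_quadrant r.
Proof.
move=> [_ ux0 u0y _ _]; case: r => x y [/= x0 y0] u_gt0.
split=> /=; rewrite lt_neqAle ?x0 ?y0 andbT; apply: contraTneq u_gt0 => <-;
  by rewrite ?ux0 ?u0y // ltxx.
Qed.

(* Any excess of [phi] above the level set may be given to the agent in the
   second coordinate. *)
Lemma valid_trade_improve (R : realType) (phi u : R * R -> R)
    (S : market_state R) (i : agent) (d : R * R) :
  nonneg_valued phi -> continuous_increasing phi -> continuous_increasing u ->
  open_quadrant (cfmm S) ->
  open_quadrant (cfmm S + d) -> open_quadrant (holding S i - d) ->
  phi (cfmm S) < phi (cfmm S + d) ->
  exists2 h, valid_trade phi S i h & u (holding S i - d) < u (holding S i - h).
Proof.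
move=> phi_ge0 hphi [_ _ _ _ uy] q0 [qx qy] [qix qiy] lt_phi.
have phi0 := pos_open_quadrant phi_ge0 hphi q0.
have [cphi phix0 _ _ _] := hphi.
set r0 := cfmm S in q0 qx qy lt_phi phi0 *.
set ri := holding S i in qix qiy *.
have cf : continuous (fun y : R => phi (nonneg_part ((r0 + d).1, y))).
  move=> y; apply: (@continuous_comp _ _ _ (fun y => ((r0 + d).1, y))
    (phi \o @nonneg_part R)).
    exact: cvg_pair (@cvg_cst _ _ _ _ _) (@cvg_id _ _).
  exact: continuous_nonneg_part.
(* On the vertical segment from the axis up to [r0 + d], [phi] starts at 0 and ends above
   [phi r0]. *)
have [||y] := @IVT R (fun y => phi (nonneg_part ((r0 + d).1, y)))
  0 (r0 + d).2 (phi r0) (ltW qy).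
- exact: continuous_subspaceT cf.
- have qxy y : 0 <= y -> quadrant ((r0 + d).1, y).
    by split => //=; exact: ltW.
  rewrite !nonneg_part_id; [|exact/qxy/ltW|exact/qxy].
  rewrite phix0 ?(ltW qx) // -surjective_pairing.
  by rewrite ge_min le_max (ltW phi0) (ltW lt_phi) orbT.
rewrite in_itv /= => /andP[y_ge0 y_le].
rewrite nonneg_part_id; last by split; rewrite /= ?(ltW qx).
move=> phiy.
have y_lt : y < r0.2 + d.2.
  rewrite lt_neqAle y_le andbT; apply: contraTneq lt_phi => yE.
  by rewrite -phiy yE ltxx.
exists (d.1, y - r0.2).
  have e : r0 + (d.1, y - r0.2) = (r0.1 + d.1, y).
    by apply: injective_projections => /=; ring.
  split; rewrite -?/r0 ?e //.
    by split => //=; exact: ltW.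
  by move: qix qiy => /= qix qiy; split => /=; rewrite -/ri; lra.
rewrite [X in u X < _]surjective_pairing [X in _ < u X]surjective_pairing /=.
by apply: uy => //; move: qix qiy => /=; lra.
Qed.

Lemma best_utility_gt (R : realType) (phi u : R * R -> R)
    (S : market_state R) (i : agent) (h d : R * R) :
  nonneg_valued phi -> continuous_increasing phi -> continuous_increasing u ->
  utility_maximizing phi u S i h ->
  open_quadrant (cfmm S) ->
  open_quadrant (cfmm S + d) -> open_quadrant (holding S i - d) ->
  phi (cfmm S) < phi (cfmm S + d) -> u (holding S i - d) < u (holding S i - h).
Proof.
move=> phi0 hphi hu [_ hmax] q0 qd qid lt_phi.
have [h' /hmax le_u lt_u] := valid_trade_improve phi0 hphi hu q0 qd qid lt_phi.
exact: lt_le_trans le_u.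
Qed.

(** * Difference quotients and concavity *)

Lemma derive_near_right (R : realType) (f : R * R -> R) (a v : R * R)
    (P : set R) :
  derivable f a v -> nbhs ('D_v f a) P ->
  \forall t \near 0^'+, P (t^-1 * (f (a + t *: v) - f a)).
Proof.
move=> df PD; have /cvg_dnbhs_at_right /(_ _ PD) /= H := df.
rewrite /nbhs /= in H; refine (filterS _ H) => t /=.
by rewrite [a + _]addrC.
Qed.

Lemma derive_gt0_near (R : realType) (f : R * R -> R) (a v : R * R) :
  derivable f a v -> 0 < 'D_v f a -> \forall t \near 0^'+, f a < f (a + t *: v).
Proof.
move=> df D0; have H := derive_near_right df (lt_nbhsr D0).
near=> t; have t0 : 0 < t by near: t; exact: nbhs_right_gt.
have : 0 < t^-1 * (f (a + t *: v) - f a) by near: t.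
by rewrite pmulr_rgt0 ?invr_gt0 // subr_gt0.
Unshelve. all: by end_near. Qed.

Lemma open_quadrant_near_right (R : realType) (r v : R * R) :
  open_quadrant r -> \forall t \near 0^'+, open_quadrant (r + t *: v).
Proof.
move=> [r1 r2].
have c (k m : R) : k + t * m @[t --> 0^'+] --> k.
  apply: cvg_at_right_filter.
  have c0 : t * m @[t --> (0 : R)] --> 0 * m.
    by apply: cvgM; [exact: cvg_id|exact: cvg_cst].
  have := cvgD (@cvg_cst _ k _ (nbhs (0 : R)) _) c0.
  by rewrite mul0r addr0; apply.
near=> t; split; near: t.
  exact: cvgr_gt (c r.1 v.1) _ r1.
exact: cvgr_gt (c r.2 v.2) _ r2.
Unshelve. all: by end_near. Qed.

(** By concavity the difference quotient from [a] towards [b] is at least the full increment for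
    every [t] strictly between 0 and 1, hence so is its limit at 0. *)
Lemma le_derive_concave (R : realType) (u : R * R -> R) (a b : R * R) :
  strictly_concave u -> open_quadrant a -> open_quadrant b ->
  differentiable u a -> u b - u a <= 'D_(b - a) u a.
Proof.
move=> cu qa qb da.
rewrite leNgt; apply/negP => lt_D.
have H := derive_near_right (diff_derivable da) (lt_nbhsl lt_D).
have [t [t0 t1 tD]] : exists t, [/\ 0 < t, t < 1 &
    t^-1 * (u (a + t *: (b - a)) - u a) < u b - u a].
  near (0:R)^'+ => t; exists t; split; near: t => //.
  - exact: nbhs_right_gt.
  - exact: nbhs_right_lt.
have [ab|ab] := eqVneq a b.
  by move: tD; rewrite ab !subrr scaler0 addr0 subrr mulr0 ltxx.
have := cu b a t qb qa; rewrite eq_sym => /(_ ab t0 t1).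
move: tD; rewrite ltr_pdivrMl //.
have -> : a + t *: (b - a) = t *: b + (1 - t) *: a.
  by rewrite scalerBr scalerBl scale1r addrCA addrA.
lra.
Unshelve. all: by end_near. Qed.

Lemma derive_partialE (R : realType) (u : R * R -> R) (r v : R * R) :
  differentiable u r -> 'D_v u r = v.1 * partial_x u r + v.2 * partial_y u r.
Proof.
move=> du; rewrite /partial_x /partial_y !deriveE //.
have {1}-> : v = v.1 *: (1, 0) + v.2 *: (0, 1).
  by apply: injective_projections; rewrite /= /GRing.scale /=; ring.
by rewrite linearD !linearZ.
Qed.

(** Monotonicity alone would allow vanishing partials; the tangent inequality bounds each one below
    by the positive increment over a unit step. *)
Lemma partial_gt0 (R : realType) (u : R * R -> R) (r : R * R) :
  regular_function u -> open_quadrant r ->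
  0 < partial_x u r /\ 0 < partial_y u r.
Proof.
move=> [_ [[_ _ _ ux uy] _ [du cu] _]] qr.
have [dr _ _] := du r qr; case: qr (qr) => x0 y0 qr.
case: r x0 y0 qr dr => x y /= x0 y0 qr dr.
split.
- have qx : open_quadrant (x + 1, y) by split => /=; lra.
  have := le_derive_concave cu qr qx dr; rewrite derive_partialE //=.
  have := ux x (x + 1) y x0 ltac:(lra) y0; lra.
- have qy : open_quadrant (x, y + 1) by split => /=; lra.
  have := le_derive_concave cu qr qy dr; rewrite derive_partialE //=.
  have := uy x y (y + 1) x0 y0 ltac:(lra); lra.
Qed.

(** * Position and direction of best trades *)

(** Both functions vanish on the axes. The level of [phi] is positive and preserved by the trade;
    the null trade is valid, so the best utility is positive too. *)
Lemma best_trade_interior (R : realType) (phi u : R * R -> R)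
    (S : market_state R) (i : agent) (h : R * R) :
  regular_function phi -> regular_function u ->
  open_quadrant (cfmm S) -> open_quadrant (holding S i) ->
  utility_maximizing phi u S i h ->
  open_quadrant (cfmm S + h) /\ open_quadrant (holding S i - h).
Proof.
move=> [phi_ge0 [cphi _ _ _]] [u_ge0 [cu _ _ _]] q0 qi [[q0h eh qih] hmax].
split.
  by apply: (open_quadrant_pos cphi q0h); rewrite eh; exact: pos_open_quadrant.
apply: (open_quadrant_pos cu) => //.
apply: (lt_le_trans (pos_open_quadrant u_ge0 cu qi)).
rewrite -{1}(subr0 (holding S i)); apply: hmax.
by split; rewrite ?addr0 ?subr0 //; exact: open_quadrantW.
Qed.

(* For a nonzero trade in the wrong direction concavity gives a loss; the null
   trade is beaten by a small trade at the mean of the two prices. *)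
Lemma best_trade_sign (R : realType) (phi u : R * R -> R)
    (S : market_state R) (i : agent) (h : R * R) :
  regular_function phi -> regular_function u ->
  open_quadrant (cfmm S) -> open_quadrant (holding S i) ->
  utility_maximizing phi u S i h ->
  price phi (cfmm S) != price u (holding S i) ->
  0 < (price phi (cfmm S) - price u (holding S i)) * h.1.
Proof.
move=> hphi hu q0 qi hm pneq.
have [q0h qih] := best_trade_interior hphi hu q0 qi hm.
have [fx fy] := partial_gt0 hphi q0; have [ux uy] := partial_gt0 hu qi.
have [phi_ge0 [iphi _ [/(_ _ q0) [dphi _ _] cphi] _]] := hphi.
have [u_ge0 [iu _ [/(_ _ qi) [du _ _] cu] _]] := hu.
move: pneq; set p := price phi _; set q := price u _ => pneq.
have pE : partial_x phi (cfmm S) = p * partial_y phi (cfmm S).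
  by rewrite /p /price divfK ?gt_eqF.
have qE : partial_x u (holding S i) = q * partial_y u (holding S i).
  by rewrite /q /price divfK ?gt_eqF.
rewrite ltNge; apply/negP => h1.
have [h0|hn0] := eqVneq h 0.
  (* An exchange at price [(p + q) / 2], with the sign of [p - q] in the first coordinate: [phi]
     along [d] and [u] along [- d] both grow at rate [(p - q) ^+ 2 / 2] times their partial in y. *)
  pose d : R * R := (p - q, - ((p - q) * ((p + q) / 2))).
  have s2 : 0 < (p - q) ^+ 2 / 2.
    by rewrite divr_gt0 // exprn_even_gt0 //= subr_eq0.
  have Dphi : 0 < 'D_d phi (cfmm S).
    rewrite derive_partialE // pE /=.
    have -> : (p - q) * (p * partial_y phi (cfmm S)) +
        - ((p - q) * ((p + q) / 2)) * partial_y phi (cfmm S) =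
      (p - q) ^+ 2 / 2 * partial_y phi (cfmm S) by field.
    exact: mulr_gt0.
  have Du : 0 < 'D_(- d) u (holding S i).
    rewrite derive_partialE // qE /=.
    have -> : - (p - q) * (q * partial_y u (holding S i)) +
        - - ((p - q) * ((p + q) / 2)) * partial_y u (holding S i) =
      (p - q) ^+ 2 / 2 * partial_y u (holding S i) by field.
    exact: mulr_gt0.
  have Hphi := derive_gt0_near (diff_derivable dphi) Dphi.
  have Hu := derive_gt0_near (diff_derivable du) Du.
  have [t [t1 t2 t3 t4]] : exists t, [/\ phi (cfmm S) < phi (cfmm S + t *: d),
      u (holding S i) < u (holding S i + t *: - d),
      open_quadrant (cfmm S + t *: d) & open_quadrant (holding S i + t *: - d)].
    by near (0:R)^'+ => t; exists t; split; near: t => //;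
      exact: open_quadrant_near_right.
  rewrite scalerN in t2 t4.
  have := best_utility_gt phi_ge0 iphi iu hm q0 t3 t4 t1.
  by rewrite h0 subr0 => /(lt_trans t2); rewrite ltxx.
have [[_ eh _] hmax] := hm.
have := le_derive_concave cphi q0 q0h dphi.
rewrite eh subrr [cfmm S + h]addrC addrK derive_partialE // pE.
have -> : h.1 * (p * partial_y phi (cfmm S)) + h.2 * partial_y phi (cfmm S) =
  (h.1 * p + h.2) * partial_y phi (cfmm S) by ring.
rewrite pmulr_lge0 // => ph.
(* Replacing [p] by [q] in [ph] adds [(q - p) * h.1], which is nonnegative by [h1]. *)
have qh : 0 <= h.1 * q + h.2 by lra.
have u_le : u (holding S i) <= u (holding S i - h).
  rewrite -{1}(subr0 (holding S i)); apply: hmax.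
  by split; rewrite ?addr0 ?subr0 //; exact: open_quadrantW.
(* The tangent inequality is not strict, so it is applied at the midpoint: strict concavity puts the
   utility there above the current one, the tangent puts it at or below. *)
have ne : holding S i != holding S i - h.
  by rewrite -subr_eq0 opprB addrC subrK.
have h2 : (0 : R) < 1 / 2 by lra.
have h21 : (1 / 2 : R) < 1 by lra.
have := cu _ _ _ qi qih ne h2 h21.
set m := _ *: _ + _; move=> um.
have mE : m = holding S i - (1 / 2) *: h.
  by apply: injective_projections; rewrite /m /= /GRing.scale /=; field.
have qm : open_quadrant m.
  move: qi qih => [/= ? ?] [/= ? ?].
  by rewrite mE; split; rewrite /= /GRing.scale /=; lra.
have := le_derive_concave cu qi qm du.
rewrite mE [holding S i - _]addrC addrK derive_partialE // qE.
rewrite /= /GRing.scale /=.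
rewrite [- _ + _]addrC -mE.
have -> : - (1 / 2 * h.1) * (q * partial_y u (holding S i)) +
    - (1 / 2 * h.2) * partial_y u (holding S i) =
  - (1 / 2 * ((h.1 * q + h.2) * partial_y u (holding S i))) by field.
have := mulr_ge0 qh (ltW uy).
lra.
Unshelve. all: by end_near. Qed.

(** * Convexity of the level curves *)

(** The open chord from [a] to [c] lies strictly above the level. Its point [m] over the abscissa of
    [b] is therefore above [b], and [a + c - b] is above the mirror point [m' = a + c - m] of the
    chord by the same amount. *)
Lemma level_parallelogram (R : realType) (phi : R * R -> R) (a b c : R * R) :
  continuous_increasing phi -> strictly_concave phi ->
  open_quadrant a -> open_quadrant b -> open_quadrant c ->
  phi a = phi b -> phi c = phi b -> 0 < (b.1 - a.1) * (c.1 - b.1) ->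
  open_quadrant (a + c - b) /\ phi b < phi (a + c - b).
Proof.
(* The claim is symmetric in [a] and [c], and equal abscissas would make the product nonpositive. *)
move=> iphi cphi; wlog ac : a c / a.1 < c.1.
  move=> H qa qb qc ea ec bac; have [?|ca|E] := ltgtP a.1 c.1.
  - exact: H.
  - by rewrite [a + c]addrC; apply: H => //; rewrite mulrC -mulrNN !opprB.
  - by move: bac; rewrite E -opprB mulNr -expr2 oppr_gt0 ltNge sqr_ge0.
move=> [a1 a2] [b1 b2] [c1 c2] ea ec bac.
have [_ _ _ _ phiy] := iphi.
have ab : a.1 < b.1 by nra.
have bc : b.1 < c.1 by nra.
(* Weight of [c] in the chord point [m] over [b]; [m'] has the two weights exchanged. *)
pose t := (b.1 - a.1) / (c.1 - a.1).
have tE : t * (c.1 - a.1) = b.1 - a.1 by rewrite /t divfK // gt_eqF; lra.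
have t0 : 0 < t by rewrite divr_gt0; lra.
have t1 : t < 1 by rewrite ltr_pdivrMr; lra.
have t0' : 0 < 1 - t by lra.
have t1' : 1 - t < 1 by lra.
have ne : a != c by apply: contraTneq ac => ->; rewrite ltxx.
have := cphi a c _ (conj a1 a2) (conj c1 c2) ne t0' t1'.
have := cphi a c _ (conj a1 a2) (conj c1 c2) ne t0 t1.
rewrite ea ec; set m' := t *: a + _; set m := _ *: a + _ => gt_m' gt_m.
have m1 : m.1 = b.1 by rewrite /m /= /GRing.scale /=; lra.
have m2 : 0 < m.2.
  rewrite /m /= /GRing.scale /=.
  by have := mulr_gt0 t0 c2; have := mulr_gt0 t0' a2; lra.
have m'1 : 0 < m'.1.
  rewrite /m' /= /GRing.scale /=.
  by have := mulr_gt0 t0 a1; have := mulr_gt0 t0' c1; lra.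
have m'2 : 0 < m'.2.
  rewrite /m' /= /GRing.scale /=.
  by have := mulr_gt0 t0 a2; have := mulr_gt0 t0' c2; lra.
have b2m : b.2 < m.2.
  rewrite ltNge; apply/negP => mb.
  have : phi m <= phi b.
    rewrite (surjective_pairing m) (surjective_pairing b) m1.
    have [->//|/eqP mb'] := eqVneq m.2 b.2.
    by apply/ltW/phiy => //; rewrite lt_neqAle mb andbT; exact/eqP.
  lra.
have dE : a + c - b = (m'.1, m'.2 + (m.2 - b.2)).
  apply: injective_projections.
    by move: m1; rewrite /m /m' /= /GRing.scale /=; lra.
  by rewrite /m /m' /= /GRing.scale /=; ring.
have lt_d : m'.2 < m'.2 + (m.2 - b.2) by lra.
rewrite dE; split; first by split; [exact: m'1 | exact: lt_trans lt_d].
apply: (@lt_trans _ _ (phi m')); first by lra.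
by rewrite [X in phi X < _]surjective_pairing; exact: phiy.
Qed.

(* At [S'] the trade [h] brings the CFMM strictly above its level curve. *)
Lemma best_utility_lt (R : realType) (phi u : R * R -> R)
    (S S' : market_state R) (i : agent) (h h' : R * R) :
  regular_function phi -> regular_function u ->
  open_quadrant (cfmm S) -> open_quadrant (cfmm S') ->
  open_quadrant (holding S i) ->
  phi (cfmm S') = phi (cfmm S) -> holding S' i = holding S i ->
  utility_maximizing phi u S i h -> utility_maximizing phi u S' i h' ->
  0 < ((cfmm S).1 - (cfmm S').1) * h.1 ->
  u (holding S i - h) < u (holding S' i - h').
Proof.
move=> hphi hu q0 q0' qi ephi ei hm hm' sgn.
have [q0h qih] := best_trade_interior hphi hu q0 qi hm.
have [phi_ge0 [iphi _ [_ cphi] _]] := hphi; have [_ [iu _ _ _]] := hu.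
have [[_ eh _] _] := hm.
have := level_parallelogram iphi cphi q0' q0 q0h ephi eh.
have -> : cfmm S' + (cfmm S + h) - cfmm S = cfmm S' + h.
  by rewrite addrCA [cfmm S + _]addrC addrK.
have -> : (cfmm S + h).1 - (cfmm S).1 = h.1 by rewrite /=; ring.
move=> /(_ sgn) [q0'h]; rewrite -ephi => lt_phi; rewrite -ei.
by apply: (best_utility_gt phi_ge0 iphi iu hm' q0' q0'h _ lt_phi); rewrite ei.
Qed.

(** * Comparison of the two orders of trading *)

Lemma mulr_gt0_trans (R : realDomainType) (a b c : R) :
  0 < a * b -> 0 < b * c -> 0 < a * c.
Proof.
move=> ab bc.
have b0 : b != 0 by apply: contraTneq ab => ->; rewrite mulr0 ltxx.
have : 0 < b ^+ 2 * (a * c).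
  have <- : a * b * (b * c) = b ^+ 2 * (a * c) by ring.
  exact: mulr_gt0.
by rewrite pmulr_rgt0 // exprn_even_gt0.
Qed.

Lemma cfmm_after (R : realType) (phi u : R * R -> R) (i : agent)
    (S : market_state R) :
  cfmm (after_best_trade phi u i S) = cfmm S + best_trade phi u S i.
Proof. by case: i. Qed.

Lemma holding_after (R : realType) (phi u : R * R -> R) (i : agent)
    (S : market_state R) :
  holding (after_best_trade phi u i S) i = holding S i - best_trade phi u S i.
Proof. by case: i. Qed.

Lemma holding_after_other (R : realType) (phi u : R * R -> R) (i j : agent)
    (S : market_state R) :
  i <> j -> holding (after_best_trade phi u j S) i = holding S i.
Proof. by case: i; case: j. Qed.

Lemma regular_best_tradeP (R : realType) (phi u : R * R -> R)
    (S : market_state R) (i : agent) :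
  regular_function phi -> regular_function u ->
  open_quadrant (cfmm S) -> open_quadrant (holding S i) ->
  utility_maximizing phi u S i (best_trade phi u S i).
Proof.
move=> [_ [[cphi _ _ _ _] _ _ _]] [_ [[cu _ _ _ _] _ _ _]] q0 qi.
by apply: best_tradeP => //; exact: open_quadrantW.
Qed.

(** Compares agent [i] trading first with trading after [j], so that the theorem follows by
    exchanging the agents. Her holding is the same in [S] and [S']; only the CFMM inventory
    differs. *)
Lemma trade_order (R : realType) (phi u v : R * R -> R) (S : market_state R)
    (i j : agent) (S' := after_best_trade phi v j S)
    (p0 := price phi (cfmm S)) (pi := price u (holding S i))
    (pj := price v (holding S j)) (q := price phi (cfmm S')) :
  regular_function phi -> regular_function u -> regular_function v ->
  interior_state S -> i <> j ->
  (0 < (p0 - pi) * (p0 - pj) -> 0 < (p0 - pi) * (q - pi) ->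
   u (holding (after_best_trade phi u i S') i) <
   u (holding (after_best_trade phi u i S) i)) /\
  ((p0 - pi) * (p0 - pj) < 0 ->
   u (holding (after_best_trade phi u i S) i) <
   u (holding (after_best_trade phi u i S') i)).
Proof.
move=> hphi hu hv [q0 q1 q2] ij.
have qh k : open_quadrant (holding S k) by case: k.
have mj := regular_best_tradeP hphi hv q0 (qh j).
have [qj _] := best_trade_interior hphi hv q0 (qh j) mj.
have mi := regular_best_tradeP hphi hu q0 (qh i).
have q0' : open_quadrant (cfmm S') by rewrite cfmm_after.
have eh : holding S' i = holding S i by exact: holding_after_other.
have qi' : open_quadrant (holding S' i) by rewrite eh.
have mi' := regular_best_tradeP hphi hu q0' qi'.
have ephi : phi (cfmm S') = phi (cfmm S) by rewrite cfmm_after; case: mj => -[].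
have dE : (cfmm S').1 - (cfmm S).1 = (best_trade phi v S j).1.
  by rewrite cfmm_after /=; ring.
have sj := best_trade_sign hphi hv q0 (qh j) mj.
have si := best_trade_sign hphi hu q0 (qh i) mi.
have si' := best_trade_sign hphi hu q0' qi' mi'.
rewrite !holding_after; split=> [ij_gt0 iq_gt0|ij_lt0].
(* Here [S] plays the role of [A]: the trade of [j] has the sign of [p0 - pj], hence of [p0 - pi]
   and of [q - pi], which is that of the later trade of [i]. *)
- apply: (best_utility_lt hphi hu q0' q0 qi' _ _ mi' mi) => //.
  rewrite dE; rewrite eh in si'.
  have /si' {}si' : q != pi.
    by apply: contraTneq iq_gt0 => ->; rewrite subrr mulr0 ltxx.
  have /sj {}sj : p0 != pj.
    by apply: contraTneq ij_gt0 => ->; rewrite subrr mulr0 ltxx.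
  apply: (mulr_gt0_trans _ si'); apply: mulr_gt0_trans iq_gt0.
  by apply: (@mulr_gt0_trans _ _ (p0 - pj)); rewrite mulrC.
(* Now [S'] plays the role of [A]: undoing the trade of [j] leads from [S'] to [S], in the same
   direction as the trade of [i] at [S]. *)
- apply: (best_utility_lt hphi hu q0 q0' (qh i) _ _ mi mi') => //.
  rewrite -opprB dE.
  have /si {}si : p0 != pi.
    by apply: contraTneq ij_lt0 => ->; rewrite subrr mul0r ltxx.
  have /sj {}sj : p0 != pj.
    by apply: contraTneq ij_lt0 => ->; rewrite subrr mulr0 ltxx.
  apply: (mulr_gt0_trans _ si).
  apply: (@mulr_gt0_trans _ _ (- (p0 - pj))).
    by rewrite mulrNN mulrC.
  by rewrite mulNr oppr_gt0 mulrC.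
Qed.

Theorem corollary3 (R : realType) (phi u1 u2 : R * R -> R)
    (S0 : market_state R)
    (hphi : regular_function phi) (hu1 : regular_function u1)
    (hu2 : regular_function u2) (hS0 : interior_state S0) :
  let T1 := after_best_trade phi u1 agent1 in
  let T2 := after_best_trade phi u2 agent2 in
  let p0 := price phi (cfmm S0) in
  let p1 := price u1 (holding1 S0) in
  let p2 := price u2 (holding2 S0) in
  let q1 := price phi (cfmm (T1 S0)) in
  let q2 := price phi (cfmm (T2 S0)) in
  let S12 := T2 (T1 S0) in
  let S21 := T1 (T2 S0) in
  (0 < (p0 - p1) * (p0 - p2) ->
   0 < (p0 - p1) * (q2 - p1) ->
   0 < (p0 - p2) * (q1 - p2) ->
   u1 (holding1 S21) < u1 (holding1 S12) /\
   u2 (holding2 S12) < u2 (holding2 S21)) /\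
  ((p0 - p1) * (p0 - p2) < 0 ->
   u1 (holding1 S12) < u1 (holding1 S21) /\
   u2 (holding2 S21) < u2 (holding2 S12)).
Proof.
move=> T1 T2 p0 p1 p2 q1 q2 S12 S21.
(* The second trader leaves the first one's holding unchanged, so [holding1 S12] is by computation
   the holding of agent 1 in [T1 S0]; likewise for agent 2 in [S21]. *)
have [//|i1 ii1] :=
  @trade_order _ phi u1 u2 S0 agent1 agent2 hphi hu1 hu2 hS0.
have [//|i2 ii2] :=
  @trade_order _ phi u2 u1 S0 agent2 agent1 hphi hu2 hu1 hS0.
split=> [h12 hq2 hq1|h12]; split.
- exact: i1.
- by apply: i2; rewrite // mulrC.
- exact: ii1.
- by apply: ii2; rewrite mulrC.
Qed.
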